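(* Let $\kappa$ be an uncountable cardinal with $2^{<\kappa}=\kappa$, and let $X$ be a nonempty regular Hausdorff space of weight at most $\kappa$. For every $1\le\alpha<\operatorname{ord}_{\kappa^+}(X)$, we have that (1) $\kappa^+\text{-}\boldsymbol{\Delta}^0_\alpha(X)\subsetneq\kappa^+\text{-}\boldsymbol{\Sigma}^0_\alpha(X)$ (equivalently, $\kappa^+\text{-}\boldsymbol{\Delta}^0_\alpha(X)\subsetneq\kappa^+\text{-}\boldsymbol{\Pi}^0_\alpha(X)$), and (2) $\bigcup_{1\le\beta<\alpha}\left(\kappa^+\text{-}\boldsymbol{\Sigma}^0_\beta(X)\cup\kappa^+\text{-}\boldsymbol{\Pi}^0_\beta(X)\right)\subsetneq\kappa^+\text{-}\boldsymbol{\Delta}^0_\alpha(X)$.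
   Context: For a topological space $X$, define by recursion on ordinals $\alpha\ge1$: $\kappa^+\text{-}\boldsymbol{\Sigma}^0_1(X)$ is the family of open sets; for $\alpha>1$, $\kappa^+\text{-}\boldsymbol{\Sigma}^0_\alpha(X)$ is the family of all unions of at most $\kappa$-many sets from $\bigcup_{1\le\beta<\alpha}\kappa^+\text{-}\boldsymbol{\Pi}^0_\beta(X)$; $\kappa^+\text{-}\boldsymbol{\Pi}^0_\alpha(X)$ is the family of complements of sets in $\kappa^+\text{-}\boldsymbol{\Sigma}^0_\alpha(X)$; $\kappa^+\text{-}\boldsymbol{\Delta}^0_\alpha(X)=\kappa^+\text{-}\boldsymbol{\Sigma}^0_\alpha(X)\cap\kappa^+\text{-}\boldsymbol{\Pi}^0_\alpha(X)$. $\kappa^+\text{-}\mathbf{Bor}(X)$ is the smallest family of subsets of $X$ containing the open sets and closed under complements and unions of size at most $\kappa$. Then $\operatorname{ord}_{\kappa^+}(X)=\min\{\alpha\mid\kappa^+\text{-}\boldsymbol{\Sigma}^0_\alpha(X)=\kappa^+\text{-}\mathbf{Bor}(X)\}$. *)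

(* Defs.v *)
From mathcomp Require Import all_boot all_order.
From mathcomp Require Import boolp classical_sets functions wochoice cardinality.
From mathcomp Require Import topology.

Set Implicit Arguments.
Unset Strict Implicit.
Unset Printing Implicit Defensive.

Local Open Scope classical_set_scope.
Local Open Scope card_scope.

(* A cardinal kappa is represented by a type K: kappa is the cardinality of
   [set: K].  An ordinal is represented by an element a of a well-ordered
   type W: it is the order type of [set b | b < a].  In particular the least
   element of W stands for the ordinal 0. *)

Definition card_lt (T U : Type) (A : set T) (B : set U) : Prop :=
  A #<= B /\ ~ (B #<= A).

(* 2^{<kappa} = kappa, where 2^{<kappa} is the supremum of the cardinals
   2^lambda for lambda < kappa. *)
Definition two_pow_lt_eq (K : Type) : Prop :=
  (forall A : set K, card_lt A [set: K] -> [set B | B `<=` A] #<= [set: K]) /\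
  (forall V : Type,
    (forall A : set K, card_lt A [set: K] -> [set B | B `<=` A] #<= [set: V]) ->
    [set: K] #<= [set: V]).

Definition weight_le (X : topologicalType) (K : Type) : Prop :=
  exists2 B : set (set X), basis B & B #<= [set: K].

Section Ordinals.
Context {d : Order.disp_t} {W : orderType d}.

Definition ord_ge1 (a : W) : Prop := exists b : W, (b < a)%O.

Definition ord_gt1 (a : W) : Prop := exists2 b : W, ord_ge1 b & (b < a)%O.

Definition ord_eq1 (a : W) : Prop := ord_ge1 a /\ ~ ord_gt1 a.

End Ordinals.

Section BorelHierarchy.
Variables (K : Type) (X : topologicalType).

Definition kunions (G : set (set X)) : set (set X) :=
  [set A | exists F : set (set X),
    [/\ F `<=` G, F #<= [set: K] & A = \bigcup_(B in F) B]].

Definition kBor : set (set X) :=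
  smallest [set M : set (set X) |
    (forall A, M A -> M (~` A)) /\ kunions M `<=` M] open.

Context {d : Order.disp_t} {W : orderType d}.

(* The recursion on ordinals, as an inductive predicate; the recursion
   equations are kSigma1E, kSigmaE and kPiE below. *)
Inductive kSigma : W -> set (set X) :=
| kSigma_open a A : ord_eq1 a -> open A -> kSigma a A
| kSigma_union a (F : set (set X)) : ord_gt1 a -> F #<= [set: K] ->
    (forall B, F B -> exists2 b, ord_ge1 b /\ (b < a)%O & kPi b B) ->
    kSigma a (\bigcup_(B in F) B)
with kPi : W -> set (set X) :=
| kPi_compl a A : kSigma a A -> kPi a (~` A).

Lemma kSigma1E (a : W) : ord_eq1 a -> kSigma a = open.
Proof.
move=> a1; apply/seteqP; split=> A; last exact: kSigma_open.
move=> aA; case: aA a1 => [//|b F gt1 _ _ [_ /(_ gt1)//]].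
Qed.

Lemma kSigmaE (a : W) : ord_gt1 a ->
  kSigma a = kunions (\bigcup_(b in [set b | ord_ge1 b /\ (b < a)%O]) kPi b).
Proof.
move=> a1; apply/seteqP; split=> A.
- move=> aA; case: aA a1 => [b B [_ nb1] _ /nb1//|b F _ FK Fb _].
  by exists F; split=> // B /Fb [c]; exists c.
- by move=> [F [Fb FK ->]]; apply: kSigma_union => // B /Fb [b]; exists b.
Qed.

Lemma kPiE (a : W) : kPi a = [set ~` A | A in kSigma a].
Proof.
apply/seteqP; split=> A; first by case=> b B bB; exists B.
by move=> [B aB <-]; exact: kPi_compl.
Qed.

Definition kDelta (a : W) : set (set X) := kSigma a `&` kPi a.

(* o is ord_{kappa^+}(X) *)
Definition is_ord (o : W) : Prop :=
  [/\ ord_ge1 o, kSigma o = kBor &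
    forall b : W, ord_ge1 b -> kSigma b = kBor -> (o <= b)%O].

End BorelHierarchy.

Arguments kSigma K X {d W}.
Arguments kPi K X {d W}.
Arguments kDelta K X {d W}.
Arguments is_ord K X {d W}.

(* Main.v *)
Require Import Defs.
From mathcomp Require Import all_boot all_order.
From mathcomp Require Import boolp classical_sets functions wochoice cardinality.
From mathcomp Require Import topology.

Set Implicit Arguments.
Unset Strict Implicit.
Unset Printing Implicit Defensive.

Import Order.TTheory.

Local Open Scope classical_set_scope.
Local Open Scope card_scope.

(** Write Sigma_a, Pi_a, Delta_a for the levels.  Say that a level c collapses
    on a set D when every Sigma_c subset of D is Pi_c.  If a level c collapses
    on the whole space, then Sigma_c is closed under complements; it is closed
    under kappa-unions and contains the open sets in any case, so it is all of
    the kappa^+-Borel sets and the order of the space is at most c.  Hence no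
    level below the order collapses on the space ([bad_below_ord]), which is
    exactly the first half of the theorem.

    For the second half, the lower levels are clearly inside Delta_a, and one
    needs a Delta_a set lying in none of them.  Three facts are combined.
    Collapse passes to unions of at most kappa sets of low complexity
    ([collapsed_bigcup]).  Every level collapses on subsets of a point.
    Consequently, a simple set D on which c does not collapse is split by some
    open U into two parts on which c still does not collapse ([bad_split]):
    otherwise each basic open set has a collapsing side, and D is the union of
    these kappa many sides and of at most one remaining point, because basic
    open sets separate points.

    If a = b + 1 with b > 1, split the space once for the level b, take a
    Sigma_b set that is not Pi_b in one half and the complement, relative to
    the other half, of such a set there: the union is Delta_a but neither
    Sigma_b nor Pi_b ([successor_step]).  For a = 2 the same is done by hand
    around two non-isolated points ([second_step]); with fewer than two of
    them, every set is open or closed.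

    If a is a limit, then it has cofinality at most kappa, as otherwise Sigma_a
    would be the union of the lower levels and a would collapse on the space.
    If all Delta_a sets had rank below a, then there could be no kappa many
    disjoint sets of bounded rank on which a fails to collapse: picking in each
    a subset of large rank, the union would be Delta_a of unbounded rank
    ([no_disjoint_bad_family]).  Now well-order kappa so that every proper
    initial segment has size less than kappa, and split the space repeatedly
    along this order, always keeping both halves.  Along the branch of a point
    x, the halves thrown away are disjoint and non-collapsing, so before kappa
    steps the branch must reach a cell on which a collapses.  A cell at stage k
    is determined by a subset of the segment below k, and 2^{<kappa} = kappa,
    so there are at most kappa times kappa = kappa cells.  The space is then a
    union of kappa many collapsing cells, a contradiction ([limit_step]).

    The equality kappa times kappa = kappa is obtained by recursion along the
    canonical well-order of pairs ([infinite_card_square]). *)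

(** * Cardinal comparison through functions *)

Lemma card_le_inj (T U : Type) (A : set T) (B : set U) (f : T -> U) :
  (forall x, A x -> B (f x)) ->
  (forall x y, A x -> A y -> f x = f y -> x = y) -> A #<= B.
Proof.
move=> fAB finj; have [] : $|{injfun A >-> B}|.
  by apply/injfunPex; exists f => // x y /set_mem Ax /set_mem Ay; exact: finj.
exact: inj_card_le.
Qed.

Lemma card_le_injP (T U : Type) (A : set T) (B : set U) (u0 : U) :
  A #<= B -> exists f : T -> U, (forall x, A x -> B (f x)) /\
    (forall x y, A x -> A y -> f x = f y -> x = y).
Proof.
move=> /card_leP[f].
have mA x : A x -> x \in A by move=> Ax; rewrite inE.
pose g x := if pselect (A x) is left Ax then set_val (f (SigSub (mA x Ax))) else u0.
exists g; split=> [x Ax|x y Ax Ay].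
  by rewrite /g; case: pselect => // Ax'; exact: set_valP.
rewrite /g; case: pselect => // Ax'; case: pselect => // Ay' /val_inj.
move=> /(@inj _ _ _ f) fxy.
by have := fxy (mem_set I) (mem_set I) => /(congr1 val).
Qed.

Lemma range_card_le (T U : Type) (f : U -> T) : range f #<= [set: U].
Proof. exact: card_image_le. Qed.

Lemma card_le_range (T U : Type) (A : set T) :
  A #<= [set: U] -> A !=set0 -> exists f : U -> T, A = range f.
Proof.
move=> /pfcard_geP[-> [x []]//|AU _]; have /surjfunPex[f ->] := AU.
by exists f.
Qed.

(** * Well-orders *)

Definition strict_wo (T : Type) (lt : T -> T -> Prop) :=
  [/\ well_founded lt,
      forall x y z, lt x y -> lt y z -> lt x z &
      forall x y, x <> y -> lt x y \/ lt y x].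

Lemma well_founded_min (T : Type) (lt : T -> T -> Prop) :
  well_founded lt -> forall P : set T, P !=set0 ->
  exists2 m, P m & forall x, lt x m -> ~ P x.
Proof.
move=> wf P [x Px]; move: Px; elim: (wf x) => {}x _ IH Px.
have [[y yx Py]|nP] := pselect (exists2 y, lt y x & P y); first exact: IH Py.
by exists x => // y yx Py; apply: nP; exists y.
Qed.

Lemma min_well_founded (T : Type) (lt : T -> T -> Prop) :
  (forall P : set T, P !=set0 -> exists2 m, P m & forall x, lt x m -> ~ P x) ->
  well_founded lt.
Proof.
move=> H x; apply: contrapT => nx.
have [|m nm mmin] := H [set x | ~ Acc lt x]; first by exists x.
by apply: nm; constructor => y /mmin /contrapT.
Qed.

Lemma well_order_wf (T : eqType) (R : rel T) : well_order R ->
  strict_wo (fun x y => R x y /\ x <> y).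
Proof.
move=> wo.
have tot x y : R x y \/ R y x.
  by have /orP := wo_chainW (withinW (A := predT) wo) (x := x) (y := y) isT isT.
have anti x y : R x y -> R y x -> x = y.
  move=> xy yx; apply: (wo_chain_antisymmetric (withinW (A := predT) wo)) => //.
  by rewrite xy yx.
split.
- apply: min_well_founded => P [x Px].
  have [|m [[mP mmin] _]] := wo [pred x | `[< P x >]].
    by exists x; apply/asboolP.
  exists m; first exact/asboolP.
  by move=> y [ym ney] Py; apply: ney; apply: anti => //; apply: mmin; apply/asboolP.
- move=> x y z [xy nxy] [yz nyz].
  have [|m [[mP mmin] _]] := wo (mem [:: x; y; z]).
    by exists x; rewrite !inE eqxx.
  have mx : R m x by apply: mmin; rewrite !inE eqxx.
  have my : R m y by apply: mmin; rewrite !inE eqxx orbT.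
  have mz : R m z by apply: mmin; rewrite !inE eqxx !orbT.
  move: mP; rewrite !inE => /or3P[] /eqP mE; subst m.
  + split=> // xz; subst z; apply: nxy; exact: anti.
  + by case: nxy; exact: anti.
  + by case: nyz; exact: anti.
- by move=> x y nxy; have [xy|yx] := tot x y; [left|right]; split=> // /esym.
Qed.

Lemma wf_recursion (T U : Type) (lt : T -> T -> Prop)
    (F : forall x, (forall y, lt y x -> U) -> U) :
  well_founded lt -> exists g : T -> U, forall x, g x = F x (fun y _ => g y).
Proof.
move=> wf; exists (Fix wf (fun=> U) F) => x; rewrite Fix_eq // => y f g fg.
by congr F; apply: functional_extensionality_dep => z;
  apply: functional_extensionality_dep => zy; exact: fg.
Qed.

Lemma strict_wo_inj (S T : Type) (lt : T -> T -> Prop) (f : S -> T) :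
  injective f -> strict_wo lt -> strict_wo (fun x y => lt (f x) (f y)).
Proof.
move=> finj [wf tr tot]; split.
- apply: min_well_founded => P [x Px].
  have [|_ [z Pz <-] zmin] := well_founded_min wf (P := f @` P).
    by exists (f x); exists x.
  by exists z => // y yz Py; apply: (zmin (f y)) => //; exists y.
- by move=> x y z; exact: tr.
- by move=> x y xy; apply: tot => /finj.
Qed.

Lemma strict_wo_lex (S T : Type) (lS : S -> S -> Prop) (lT : T -> T -> Prop) :
  strict_wo lS -> strict_wo lT -> strict_wo (fun p q : S * T =>
    lS p.1 q.1 \/ (p.1 = q.1 /\ lT p.2 q.2)).
Proof.
move=> [wfS trS totS] [wfT trT totT]; split.
- case=> x; elim: (wfS x) => {}x _ IHx y; elim: (wfT y) => {}y _ IHy.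
  by constructor => -[x' y'] /= [/IHx|[-> /IHy]].
- move=> [x1 y1] [x2 y2] [x3 y3] /= [x12|[-> y12]] [x23|[<- y23]]; try by left.
    by left; exact: trS x23.
  by right; split=> //; exact: trT y23.
- move=> [x1 y1] [x2 y2] ne /=.
  have [E|/totS[]] := pselect (x1 = x2); [|by left; left|by right; left].
  subst x2; have [E|/totT[]] := pselect (y1 = y2); [by subst y2|left|right];
    by right.
Qed.

(** The initial ordinal of T: if some proper initial segment of a well-order is
    as large as T, the least such segment carries the desired order, which is
    then transported to T along an injection. *)
Lemma exists_initial_wo (T : Type) : exists2 lt : T -> T -> Prop,
  strict_wo lt & forall k, ~ ([set: T] #<= [set j | lt j k]).
Proof.
have [R Rwo] := well_ordering_principle {classic T}.
pose lt (x y : T) := R x y /\ x <> y.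
have [wf tr tot] : strict_wo lt := well_order_wf Rwo.
have [small|/existsNP[k /contrapT kbig]] :=
  pselect (forall k, ~ ([set: T] #<= [set j | lt j k])).
  by exists lt.
have [|m mbig mmin] :=
  well_founded_min wf (P := [set k | [set: T] #<= [set j | lt j k]]).
  by exists k.
have [f [fm finj]] := card_le_injP m mbig.
exists (fun x y => lt (f x) (f y)).
  by apply: (strict_wo_inj (f := f)) => // x y; exact: finj.
move=> x xbig; apply: (mmin (f x)); first exact: fm.
apply: card_le_trans xbig _; apply: (card_le_inj (f := f)) => //.
by move=> ? ? _ _; exact: finj.
Qed.

(** * Squares of infinite cardinals *)

Section Square.
Variables (T : Type) (lt : T -> T -> Prop).
Hypothesis lt_wo : strict_wo lt.

Let seg (k : T) := [set j | lt j k].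

Let mx (p : T * T) := if pselect (lt p.1 p.2) is left _ then p.2 else p.1.

(* Goedel's well-order of pairs: by maximum first, then lexicographically.
   Its point is that the predecessors of p lie in a square of a segment. *)
Let god (p q : T * T) := lt (mx p) (mx q) \/
  (mx p = mx q /\ (lt p.1 q.1 \/ (p.1 = q.1 /\ lt p.2 q.2))).

Let god_wo : strict_wo god.
Proof.
have mxinj : injective (fun p => (mx p, p)) by move=> p q [].
exact: strict_wo_inj mxinj (strict_wo_lex lt_wo (strict_wo_lex lt_wo lt_wo)).
Qed.

Let mxE (p : T * T) : (forall k, lt (mx p) k -> lt p.1 k /\ lt p.2 k).
Proof.
have [wf tr tot] := lt_wo.
move=> k; rewrite /mx; case: pselect => [p12 p2k|np12 p1k].
  by split=> //; exact: tr p2k.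
split=> //; have [<-//|/tot[//|p21]] := pselect (p.1 = p.2); exact: tr p1k.
Qed.

Let god_mx (p q : T * T) k : god p q -> lt (mx q) k -> lt (mx p) k.
Proof. by have [_ tr _] := lt_wo; move=> [pq /(tr _ _ _ pq)//|[->]]. Qed.

(** A is an initial segment, or everything, in which all proper initial segments
    are strictly smaller; the segments are assumed to satisfy the conclusion.
    Each pair then has fewer than A predecessors in the order of pairs, so an
    injection into A can be built by always choosing a value not used yet. *)
Lemma square_step (A : set T) : infinite_set A ->
  (forall k, A k -> seg k `<=` A) ->
  (forall k, A k -> ~ (A #<= seg k)) ->
  (forall k, A k -> infinite_set (seg k) -> seg k `*` seg k #<= seg k) ->
  A `*` A #<= A.
Proof.
move=> Ainf Adown Asmall IH; have [wf tr tot] := lt_wo; have [wfg _ totg] := god_wo.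
have [t0 At0] := infinite_setN0 Ainf.
(* A last element k would make A as large as its segment below k: the segment
   and one more point embed into the square of the segment. *)
have Anext k : A k -> exists2 l, A l & lt k l.
  move=> Ak; apply: contrapT => nl; have Asub : A `<=` seg k `|` [set k].
    move=> l Al; have [->|/tot[lk|kl]] := pselect (l = k); [by right|by left|].
    by case: nl; exists l.
  have sinf : infinite_set (seg k).
    by move=> sfin; apply: Ainf; apply: sub_finite_set Asub _; rewrite finite_setU.
  apply: (Asmall k Ak); apply: card_le_trans (IH k Ak sinf).
  apply: card_le_trans (subset_card_le Asub) _.
  have /infiniteP/(card_le_injP k)[e [es einj]] := sinf.
  have e01 : e 0%N <> e 1%N by move=> /einj; move=> /(_ I I).
  apply: (card_le_inj (f := fun x => if pselect (lt x k) is left _ then (x, e 0%N)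
      else (e 0%N, e 1%N))) => [x _|x y xk yk].
    by case: pselect => [xk|_]; split=> //=; exact: es.
  case: pselect => [xk'|nxk]; first by case: pselect => [yk'|nyk] [].
  case: pselect => [yk' [_ E]|nyk _]; first by case: (e01 (esym E)).
  by move: xk yk => [//|->] [//|->].
pose pre p := [set q | (A `*` A) q /\ god q p].
have pre_small p : (A `*` A) p -> ~ (A #<= pre p).
  move=> [Ap1 Ap2] Apre; have Am : A (mx p) by rewrite /mx; case: pselect.
  have [k Ak mk] := Anext _ Am.
  have sub : pre p `<=` seg k `*` seg k.
    by move=> q [_ qp]; apply: mxE; exact: god_mx qp mk.
  have := card_le_trans Apre (subset_card_le sub).
  have [sinf|/contrapT sfin] := pselect (infinite_set (seg k)).
    by move=> /card_le_trans/(_ (IH k Ak sinf)); exact: Asmall.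
  by move=> /card_le_finite/(_ (finite_setX sfin sfin)).
have [g gE] := wf_recursion (fun p (rec : forall q, god q p -> T) =>
  @xget {classic T} t0 [set v : T | A v /\
    forall q (qp : god q p), (A `*` A) q -> rec q qp <> v]) wfg.
have gP p : (A `*` A) p -> A (g p) /\ forall q, pre p q -> g q <> g p.
  move=> Ap; rewrite gE; case: xgetP => [v _ [Av vne]|nov].
    by split=> // q [Aq qp]; exact: vne.
  have Ag : A `<=` g @` pre p.
    move=> v Av; apply: contrapT => nv; apply: (nov v); split=> // q qp Aq qv.
    by apply: nv; exists q.
  case: (pre_small p Ap); apply: card_le_trans (subset_card_le Ag) _.
  exact: card_image_le.
apply: (card_le_inj (f := g)) => [p /gP[]//|p q Ap Aq gpq].
apply: contrapT => /totg[pq|qp].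
  by have [_ /(_ p)] := gP q Aq; apply.
by have [_ /(_ q)] := gP p Ap; apply.
Qed.

End Square.

Theorem infinite_card_square (T : Type) : infinite_set [set: T] ->
  [set: T * T] #<= [set: T].
Proof.
move=> Tinf; have [lt lt_wo small] := exists_initial_wo T.
have [wf tr tot] := lt_wo; rewrite -setXTT.
apply: (square_step lt_wo) => // k _.
elim: (wf k) => {}k _ IH kinf.
have [[j jk kj]|nj] :=
  pselect (exists2 j, lt j k & [set i | lt i k] #<= [set i | lt i j]).
  have jinf : infinite_set [set i | lt i j].
    by move=> /(card_le_finite kj).
  have [f [fj finj]] := card_le_injP k kj.
  apply: card_le_trans (card_le_trans (IH j jk jinf) _); last first.
    by apply: subset_card_le => i; move=> /tr; apply.
  apply: (card_le_inj (f := fun p => (f p.1, f p.2))) => [p [? ?]|p q [? ?] [? ?]].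
    by split; exact: fj.
  case=> /finj e1 /finj e2.
  by rewrite (surjective_pairing p) e1// e2// -surjective_pairing.
apply: (square_step lt_wo) => // [i ik j ji|j jk ej]; first exact: tr ik.
by apply: nj; exists j.
Qed.

(** * Closure properties of the levels *)

Section Levels.
Variables (K : Type) (X : topologicalType) (d : Order.disp_t) (W : orderType d).
Hypothesis Kinf : infinite_set [set: K].
Hypothesis Wwf : well_founded (fun x y : W => (x < y)%O).
Hypothesis regX : regular_space X.
Hypothesis weightX : weight_le X K.
Implicit Types (a b c : W) (A B D U : set X).

Local Notation Sg := (kSigma K X).
Local Notation Pg := (kPi K X).

Lemma PiP c A : Pg c A <-> Sg c (~` A).
Proof.
split=> [[b B cB]|cA]; first by rewrite setCK.
by rewrite -(setCK A); exact: kPi_compl.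
Qed.

Lemma ord_ge1_cases c : ord_ge1 c -> ord_eq1 c \/ ord_gt1 c.
Proof. by move=> c1; have [|] := pselect (ord_gt1 c); [right|left]. Qed.

Lemma ord_gt1_ge1 c : ord_gt1 c -> ord_ge1 c.
Proof. by move=> [b _ bc]; exists b. Qed.

Lemma ord_ge1_le b c : ord_ge1 b -> (b <= c)%O -> ord_ge1 c.
Proof. by move=> [e eb] bc; exists e; exact: lt_le_trans bc. Qed.

Lemma ord_gt1_le b c : ord_gt1 b -> (b <= c)%O -> ord_gt1 c.
Proof. by move=> [e e1 eb] bc; exists e => //; exact: lt_le_trans bc. Qed.

Lemma ord_one_lt c : ord_gt1 c -> exists2 e, ord_eq1 e & (e < c)%O.
Proof.
move=> [b b1 bc]; have [|e e1 emin] := well_founded_min Wwf (P := @ord_ge1 d W).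
  by exists b.
exists e; first by split=> // -[x x1 xe]; exact: emin xe x1.
apply: le_lt_trans bc.
by rewrite leNgt; apply/negP => /emin.
Qed.

(** The recursion equation with Pi eliminated in favour of Sigma of the
    complement, the form in which all levels are handled below. *)
Lemma SigmaP c A : ord_gt1 c -> Sg c A <->
  exists2 F : set (set X), F #<= [set: K] /\
    (forall B, F B -> exists b, [/\ ord_ge1 b, (b < c)%O & Sg b (~` B)]) &
    A = \bigcup_(B in F) B.
Proof.
move=> c1; split=> [|[F [FK Fb] ->]].
  rewrite kSigmaE// => -[F [Fb FK ->]]; exists F => //; split=> // B /Fb[b [b1 bc]].
  by move=> /PiP bB; exists b.
by apply: kSigma_union => // B /Fb[b [b1 bc /PiP bB]]; exists b.
Qed.

(** This is where regularity and the weight enter: an open set is the union of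
    the closures, contained in it, of basic open sets. *)
Lemma open_Sigma c A : ord_ge1 c -> open A -> Sg c A.
Proof.
move=> /ord_ge1_cases[c1|c1] oA; first exact: kSigma_open.
have [B [Bop Bnbhs] BK] := weightX; have [e e1 ec] := ord_one_lt c1.
apply/SigmaP => //; exists [set closure U | U in B `&` [set U | closure U `<=` A]].
  split.
    apply: card_le_trans BK; apply: card_le_trans (card_image_le _ _) _.
    by apply: subset_card_le => U [].
  move=> _ [U _ <-]; exists e; split=> //; first by case: e1.
  by apply: kSigma_open => //; exact/closed_openC/closed_closure.
apply/seteqP; split=> [x Ax|x [_ [U [_ UA] <-]] /UA//].
have [V xV VA] : filter_from (nbhs x) closure A.
  by apply: regX; exact: open_nbhs_nbhs.
have [U [BU Ux] UV] := Bnbhs x V xV.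
exists (closure U); last exact: subset_closure.
by exists U => //; split=> //; apply: subset_trans VA; exact: closureS.
Qed.

Lemma closed_SigmaC c A : ord_ge1 c -> closed A -> Sg c (~` A).
Proof. by move=> c1 cA; apply: open_Sigma => //; exact: closed_openC. Qed.

Lemma Pi_Sigma b c A : ord_ge1 b -> (b < c)%O -> Sg b (~` A) -> Sg c A.
Proof.
move=> b1 bc bA; apply/SigmaP; first by exists b.
exists [set A]; last by rewrite bigcup_set1.
split; last by move=> _ ->; exists b.
rewrite (_ : [set A] = [set A | _ in [set: K]]); first exact: range_card_le.
have [k _] := infinite_setN0 Kinf.
by apply/seteqP; split=> [_ ->|_ [_ _ <-]//]; exists k.
Qed.

Lemma Sigma_le b c A : ord_ge1 b -> (b <= c)%O -> Sg b A -> Sg c A.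
Proof.
move=> b1; rewrite le_eqVlt => /predU1P[->//|bc].
have [be1|bgt1] := ord_ge1_cases b1.
  by rewrite kSigma1E// => /open_Sigma; apply; exists b; case: b1.
move=> /(SigmaP _ bgt1)[F [FK Fb] ->].
apply/SigmaP; first by exists b.
exists F => //; split=> // B /Fb[e [e1 eb eB]]; exists e; split=> //.
exact: lt_trans bc.
Qed.

Lemma Sigma_Pi b c A : ord_ge1 b -> (b < c)%O -> Sg b A -> Sg c (~` A).
Proof. by move=> b1 bc bA; apply: (Pi_Sigma b1 bc); rewrite setCK. Qed.

Lemma Sigma0 c : ord_ge1 c -> Sg c set0.
Proof. by move=> c1; apply: open_Sigma => //; exact: open0. Qed.

(** At levels above 1 the union is over a family of families, so a member is
    coded by the index of a family containing it and its index there; this uses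
    kappa times kappa = kappa. *)
Lemma Sigma_bigcup (I : Type) (P : set I) (f : I -> set X) c : ord_ge1 c ->
  P #<= [set: K] -> (forall i, P i -> Sg c (f i)) ->
  Sg c (\bigcup_(i in P) f i).
Proof.
move=> c1 PK fc; have [ce1|cgt1] := ord_ge1_cases c1.
  by rewrite kSigma1E//; apply: bigcup_open => i /fc; rewrite kSigma1E.
have [->|P0] := eqVneq P set0; first by rewrite bigcup_set0; exact: Sigma0.
have [g Pg] := card_le_range PK (proj1 (set0P _) P0).
have gP k : P (g k) by rewrite Pg; exists k.
have /choice[F HF] : forall k, exists F : set (set X), [/\ F #<= [set: K],
    (forall B, F B -> exists b, [/\ ord_ge1 b, (b < c)%O & Sg b (~` B)]) &
    f (g k) = \bigcup_(B in F) B].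
  by move=> k; have /(SigmaP _ cgt1)[F [FK Fb] ->] := fc _ (gP k); exists F.
apply/SigmaP => //; exists (\bigcup_k F k).
  split; last by move=> B [k _]; have [_ /(_ B)] := HF k.
  apply: card_le_trans (infinite_card_square Kinf).
  have [k0 _] := infinite_setN0 Kinf.
  have /choice[h hF] : forall k, exists h : set X -> K,
      forall x y, F k x -> F k y -> h x = h y -> x = y.
    move=> k; have [FK _ _] := HF k.
    by have [h [_ hinj]] := card_le_injP k0 FK; exists h.
  have /choice[r rF] : forall B, exists k, (\bigcup_k F k) B -> F k B.
    move=> B; have [[k _ FB]|nB] := pselect ((\bigcup_k F k) B); first by exists k.
    by exists k0.
  apply: (card_le_inj (f := fun B => (r B, h (r B) B))) => // A B UA UB [rE].
  by rewrite -rE; apply: hF; [exact: rF | rewrite rE; exact: rF].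
apply/seteqP; split=> x.
  move=> [i]; rewrite Pg => -[k _ <-]; have [_ _ ->] := HF k => -[B FB Bx].
  by exists B => //; exists k.
move=> [B [k _ FB] Bx]; exists (g k) => //; have [_ _ ->] := HF k.
by exists B.
Qed.

Lemma countable_card_le (I : Type) (P : set I) : countable P -> P #<= [set: K].
Proof.
by move=> Pc; apply: (card_le_trans Pc); exact/infiniteP.
Qed.

Lemma setU_bool A B : A `|` B = \bigcup_(i in [set: bool]) (if i then A else B).
Proof.
apply/seteqP; split=> x; first by move=> [Ax|Bx]; [exists true|exists false].
by move=> [[] _ ?]; [left|right].
Qed.

Lemma Sigma_setU c A B : ord_ge1 c -> Sg c A -> Sg c B -> Sg c (A `|` B).
Proof.
move=> c1 cA cB; rewrite setU_bool; apply: Sigma_bigcup => [//||[]//].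
exact/countable_card_le/countableP.
Qed.

Lemma Sigma_setI c A B : ord_ge1 c -> Sg c A -> Sg c B -> Sg c (A `&` B).
Proof.
move=> c1; have [ce1|cgt1] := ord_ge1_cases c1.
  by rewrite !kSigma1E//; exact: openI.
move=> /(SigmaP _ cgt1)[F [FK Fb] ->] /(SigmaP _ cgt1)[G [GK Gb] ->].
rewrite (_ : _ `&` _ = \bigcup_(C in F) \bigcup_(D in G) (C `&` D)).
  apply: Sigma_bigcup => // C /Fb[b [b1 bc bC]].
  apply: Sigma_bigcup => // D /Gb[e [e1 ec eD]].
  (* C and D are Pi at the larger of their levels, where Pi is closed under
     intersection, dually to the closure of Sigma under union *)
  apply: (Pi_Sigma (b := Order.max b e)).
  - by apply: ord_ge1_le b1 _; rewrite le_max lexx.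
  - by rewrite gt_max bc.
  rewrite setCI; apply: Sigma_setU.
  - by apply: ord_ge1_le b1 _; rewrite le_max lexx.
  - by apply: Sigma_le bC => //; rewrite le_max lexx.
  - by apply: Sigma_le eD => //; rewrite le_max lexx orbT.
apply/seteqP; split=> x.
  by move=> [[C FC Cx] [D GD Dx]]; exists C => //; exists D.
by move=> [C FC [D GD [Cx Dx]]]; split; [exists C|exists D].
Qed.

Lemma Sigma_kBor c A : ord_ge1 c -> Sg c A -> kBor K A.
Proof.
elim: (Wwf c) A => {}c _ IH A c1; have [ce1|cgt1] := ord_ge1_cases c1.
  by rewrite kSigma1E// => oA M [_]; apply.
move=> /(SigmaP _ cgt1)[F [FK Fb] ->] M HM; have [[MC MU] _] := HM; apply: (MU).
exists F; split=> // B /Fb[b [b1 bc bB]]; rewrite -(setCK B); apply: (MC).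
exact: (IH _ bc _ b1 bB M HM).
Qed.

(** * Sets on which a level collapses *)

(** The class kDelta, with Pi expressed by the complement. *)
Definition Delta c A := Sg c A /\ Sg c (~` A).

Definition collapsed c D := forall A, Sg c A -> A `<=` D -> Sg c (~` A).

(** The complement of A is the complement of the union together with the
    complements of A relative to the pieces, which are Sigma by collapse. *)
Lemma collapsed_bigcup (I : Type) (P : set I) (f : I -> set X) c : ord_ge1 c ->
  P #<= [set: K] -> (forall i, P i -> Sg c (f i)) ->
  (forall i, P i -> collapsed c (f i)) ->
  Sg c (~` \bigcup_(i in P) f i) -> collapsed c (\bigcup_(i in P) f i).
Proof.
move=> c1 PK fc gf cU A cA AU.
rewrite (_ : ~` A = (~` \bigcup_(i in P) f i) `|`
  \bigcup_(i in P) (f i `&` ~` (A `&` f i))).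
  apply: Sigma_setU => //; apply: Sigma_bigcup => // i Pi; apply: Sigma_setI => //.
    exact: fc.
  by apply: (gf i Pi) => //; apply: Sigma_setI => //; exact: fc.
apply/seteqP; split=> x.
  move=> nAx.
  have [[i Pi fx]|nU] := pselect ((\bigcup_(i in P) f i) x); last by left.
  by right; exists i => //; split=> // -[].
by move=> [nU /AU//|[i Pi [fx nA] Ax]]; apply: nA.
Qed.

Lemma collapsed_setU c A B : ord_ge1 c -> Sg c A -> Sg c B ->
  collapsed c A -> collapsed c B -> Sg c (~` (A `|` B)) -> collapsed c (A `|` B).
Proof.
move=> c1 cA cB gA gB; rewrite setU_bool => cAB.
apply: collapsed_bigcup => //; try by case.
exact/countable_card_le/countableP.
Qed.

Hypothesis hausX : hausdorff_space X.

Lemma closed_subset1 A p : A `<=` [set p] -> closed A.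
Proof.
move=> Ap; have [->|/set0P[q Aq]] := eqVneq A set0; first exact: closed0.
have <- : [set p] = A.
  by apply/seteqP; split=> // x ->; have <- := Ap _ Aq.
exact/accessible_closed_set1/hausdorff_accessible.
Qed.

Lemma collapsed_subset1 c D p : ord_ge1 c -> D `<=` [set p] -> collapsed c D.
Proof.
move=> c1 Dp A _ AD; apply: closed_SigmaC => //.
by apply: (@closed_subset1 _ p); exact: subset_trans Dp.
Qed.

Lemma closed_Sigma c A : ord_gt1 c -> closed A -> Sg c A.
Proof.
move=> c1 cA; have [e [e1 _] ec] := ord_one_lt c1.
by apply: (Pi_Sigma e1 ec); exact: closed_SigmaC.
Qed.

Lemma basis_separates (B : set (set X)) x y : basis B -> x <> y ->
  exists2 U, B U & U x /\ ~ U y.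
Proof.
move=> [_ Bn] /eqP /(hausdorff_accessible hausX)[V [oV xV yV]].
have [U [BU Ux] UV] := Bn x V (open_nbhs_nbhs (conj oV (set_mem xV))).
by exists U => //; split=> // /UV; exact: set_mem yV.
Qed.

(** If no basic open set U splits D, choose for each U a collapsing side of D;
    two points of D outside all chosen sides would be separated by some U, so
    D is covered by kappa many collapsing sides and one point. *)
Lemma bad_split c D : ord_gt1 c -> Sg c D -> Sg c (~` D) -> ~ collapsed c D ->
  exists U, [/\ open U, ~ collapsed c (D `&` U) & ~ collapsed c (D `&` ~` U)].
Proof.
move=> cgt1 cD cDC; apply: contra_notP => nosplit.
have c1 := ord_gt1_ge1 cgt1; have [B Bb BK] := weightX.
have Bop U : B U -> open U by case: Bb => + _; apply.
pose G U :=
  if pselect (collapsed c (D `&` U)) is left _ then D `&` U else D `&` ~` U.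
have GS U : B U -> Sg c (G U).
  move=> /Bop oU; rewrite /G; case: pselect => _; apply: Sigma_setI => //.
    exact: open_Sigma.
  by apply: closed_Sigma => //; exact: open_closedC.
have gG U : B U -> collapsed c (G U).
  move=> /Bop oU; rewrite /G; case: pselect => // ng.
  by apply: contrapT => ng'; apply: nosplit; exists U.
pose R := D `&` ~` \bigcup_(U in B) G U.
have R1 p : R p -> R `<=` [set p].
  move=> [Dp nGp] q [Dq nGq]; apply: contrapT => /= /nesym pq.
  have [U BU [Up nUq]] := basis_separates Bb pq.
  have [GUp|GUq] : G U p \/ G U q.
  - by rewrite /G; case: pselect => _; [left|right].
  - by apply: nGp; exists U.
  - by apply: nGq; exists U.
have clR : closed R /\ collapsed c R.
  have [->|/set0P[p /R1 Rp]] := eqVneq R set0.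
    split; first exact: closed0.
    by move=> A _; rewrite subset0 => ->; apply: closed_SigmaC => //; exact: closed0.
  by split; [exact: closed_subset1 Rp|exact: collapsed_subset1 Rp].
have GD : \bigcup_(U in B) G U `<=` D.
  by move=> x [U _]; rewrite /G; case: pselect => _ [].
have UE : D = \bigcup_(U in B) G U `|` R.
  apply/seteqP; split=> x; last by move=> [/GD//|[]].
  by move=> Dx; have [Gx|nGx] := pselect ((\bigcup_(U in B) G U) x); [left|right].
rewrite UE; apply: collapsed_setU => //.
- exact: Sigma_bigcup.
- exact: closed_Sigma (proj1 clR).
- apply: collapsed_bigcup => //.
  rewrite (_ : ~` _ = ~` D `|` R).
    by apply: Sigma_setU => //; exact: closed_Sigma (proj1 clR).
  apply/seteqP; split=> x.
    by move=> nGx; have [Dx|nDx] := pselect (D x); [right|left].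
  by move=> [nDx /GD//|[]].
- exact: (proj2 clR).
- by rewrite -UE.
Qed.

Lemma delta_below a b A : ord_ge1 b -> (b < a)%O -> Sg b A -> Delta a A.
Proof.
move=> b1 ba bA; split; last exact: Sigma_Pi bA.
by apply: Sigma_le bA => //; exact: ltW.
Qed.

(** A level collapsing on the whole space is closed under complements. *)
Lemma bad_below_ord o a : is_ord K X o -> ord_ge1 a -> (a < o)%O ->
  ~ collapsed a [set: X].
Proof.
move=> [_ _ omin] a1 ao gX; suff /(omin _ a1) : Sg a = kBor K (X := X).
  by rewrite leNgt ao.
apply/seteqP; split=> A; first exact: Sigma_kBor.
apply; split; last by move=> B; exact: open_Sigma.
split=> [B aB|B [F [Fa FK ->]]]; first exact: gX.
exact: Sigma_bigcup.
Qed.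

(** * Successor levels *)

(** Take A0 inside U and A1 outside U, both Sigma_b and not Pi_b; the witness is
    A0 together with the complement of A1 outside U.  Its trace outside U shows
    that it is not Sigma_b, its trace on U that it is not Pi_b. *)
Lemma successor_step a b : ord_gt1 b -> (b < a)%O -> ~ collapsed b [set: X] ->
  exists2 A, Delta a A & ~ Sg b A /\ ~ Sg b (~` A).
Proof.
move=> bgt1 ba badX; have b1 := ord_gt1_ge1 bgt1.
have a1 : ord_ge1 a by exists b.
have upS A : Sg b A -> Sg a A by apply: Sigma_le => //; exact: ltW.
have upP A : Sg b A -> Sg a (~` A) by exact: Sigma_Pi.
have [||U [oU]] := bad_split bgt1 _ _ badX.
- by apply: open_Sigma => //; exact: openT.
- by rewrite setCT; exact: Sigma0.
rewrite !setTI => /existsNP[A0 /not_implyP[bA0 /not_implyP[A0U nbA0]]].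
move=> /existsNP[A1 /not_implyP[bA1 /not_implyP[A1U nbA1]]].
have bU : Sg b U by exact: open_Sigma.
have bUC : Sg b (~` U) by apply: closed_Sigma => //; exact: open_closedC.
exists (A0 `|` (~` U `&` ~` A1)).
  split.
    by apply: Sigma_setU => //; [exact: upS|apply: Sigma_setI => //; auto].
  rewrite setCU setCI !setCK; apply: Sigma_setI => //; first exact: upP.
  by apply: Sigma_setU => //; exact: upS.
split=> bC.
  apply: nbA1; rewrite (_ : ~` A1 = ((A0 `|` (~` U `&` ~` A1)) `&` ~` U) `|` U).
    by apply: Sigma_setU => //; exact: Sigma_setI.
  apply/seteqP; split=> x.
    move=> nA1; have [Ux|nUx] := pselect (U x); [by right|].
    by left; split=> //; right.
  by move=> [[[/A0U//|[]//]]|Ux /A1U].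
apply: nbA0.
rewrite (_ : ~` A0 = (~` (A0 `|` (~` U `&` ~` A1)) `&` U) `|` ~` U).
  by apply: Sigma_setU => //; exact: Sigma_setI.
apply/seteqP; split=> x.
  move=> nA0; have [Ux|nUx] := pselect (U x); [left|by right].
  by split=> // -[//|[]].
by move=> [[nC Ux] A0x|nUx /A0U//]; apply: nC; left.
Qed.

(** The argument of [successor_step] is not available at level 1, where closed
    sets need not be Sigma.  Non-isolated points p, q with disjoint open
    neighbourhoods U, V take its place: U without p but with q is not open
    because of q and not closed because of p.  If there is at most one
    non-isolated point, a set missing it is open and a set containing it is
    closed. *)
Lemma second_step a : ord_gt1 a -> ~ collapsed a [set: X] ->
  exists2 A, Delta a A & ~ open A /\ ~ closed A.
Proof.
move=> agt1 badX; have a1 := ord_gt1_ge1 agt1.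
have [p [q [np nq pq]]] : exists p q : X,
    [/\ ~ open [set p], ~ open [set q] & p <> q].
  apply: contrapT => H; apply: badX => A _ _.
  have isoopen B : (forall x, B x -> open [set x]) -> open B.
    by move=> Bo; rewrite -(image_id B) -bigcup_imset1; exact: bigcup_open.
  have [[p Ap np]|nA] := pselect (exists2 p, (~` A) p & ~ open [set p]).
    apply: closed_Sigma => //; apply: open_closedC; apply: isoopen => q Aq.
    by apply: contrapT => nq; apply: H; exists p, q; split=> // pq; subst q.
  apply: open_Sigma => //; apply: isoopen => q Aq.
  by apply: contrapT => nq; apply: nA; exists q.
have /eqP := pq; move: (hausX); rewrite open_hausdorff => /[apply].
move=> [[U V] [/= /set_mem Up /set_mem Vq] [oU oV /eqP UV0]].
have UVF x : U x -> V x -> False.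
  by move=> Ux Vx; have : (U `&` V) x by []; rewrite UV0.
have cl1 (x : X) : closed [set x].
  by apply: (closed_subset1 (p := x)).
exists ((U `&` ~` [set p]) `|` [set q]).
  split.
    apply: Sigma_setU => //; last exact: closed_Sigma.
    by apply: open_Sigma => //; apply: openI => //; exact: closed_openC.
  rewrite setCU setCI setCK; apply: Sigma_setI => //.
    by apply: Sigma_setU => //; apply: closed_Sigma => //; exact: open_closedC.
  by apply: open_Sigma => //; exact: closed_openC.
split=> [oC|/closed_openC oC].
  apply: nq; rewrite (_ : [set q] = ((U `&` ~` [set p]) `|` [set q]) `&` V).
    exact: openI.
  apply/seteqP; split=> x; first by move=> ->; split=> //; right.
  by move=> [[[Ux _]|//] Vx]; case: (UVF x).
apply: np; rewrite (_ : [set p] = ~` ((U `&` ~` [set p]) `|` [set q]) `&` U).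
  exact: openI.
apply/seteqP; split=> x; first by move=> ->; split=> // -[[_ /(_ erefl)]|/pq].
by move=> [nC Ux]; apply: contrapT => xp; apply: nC; left.
Qed.

(** * Limit levels *)

Section Limit.
Variable a : W.
Hypothesis agt1 : ord_gt1 a.
Hypothesis alim : forall b, (b < a)%O -> exists2 c, (b < c)%O & (c < a)%O.
Hypothesis abad : ~ collapsed a [set: X].

Let a1 : ord_ge1 a. Proof. exact: ord_gt1_ge1. Qed.

(** If no kappa-sequence were cofinal in a, the ranks of the kappa many members
    of a Sigma_a set would be bounded, and Sigma_a would be the union of the
    lower levels, hence contained in Pi_a. *)
Lemma cofinal_family : exists f : K -> W,
  (forall k, ord_ge1 (f k) /\ (f k < a)%O) /\
  (forall b, (b < a)%O -> exists k, (b <= f k)%O).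
Proof.
apply: contrapT => nocof; apply: abad => A aA _.
have /(SigmaP _ agt1)[F [FK Fb] AF] := aA.
have [F0|/set0P F0] := eqVneq F set0.
  by rewrite AF F0 bigcup_set0 setC0; apply: open_Sigma => //; exact: openT.
have [g Fg] := card_le_range FK F0.
have /choice[f fP] : forall k, exists b, [/\ ord_ge1 b, (b < a)%O & Sg b (~` g k)].
  by move=> k; apply: Fb; rewrite Fg; exists k.
have [b ba fb] : exists2 b, (b < a)%O & forall k, (f k < b)%O.
  apply: contrapT => nb; apply: nocof; exists f.
  split=> [k|b ba]; first by have [] := fP k.
  apply: contrapT => nk; apply: nb; exists b => // k.
  by rewrite ltNge; apply/negP => bk; apply: nk; exists k.
have [k0 _] := infinite_setN0 Kinf.
have bgt1 : ord_gt1 b by exists (f k0) => //; have [] := fP k0.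
apply: (Sigma_Pi (ord_gt1_ge1 bgt1) ba); apply/SigmaP => //; exists F => //.
split=> // B; rewrite Fg => -[k _ <-]; exists (f k).
by have [] := fP k.
Qed.

(** A Sigma_a subset of D that is not Pi_a is a union of kappa many subsets of
    rank below a, which therefore cannot all be Sigma_b. *)
Lemma bad_unbounded D b : ord_ge1 b -> (b < a)%O -> ~ collapsed a D ->
  exists A, [/\ A `<=` D, exists c, [/\ ord_ge1 c, (c < a)%O & Sg c A] & ~ Sg b A].
Proof.
move=> b1 ba; apply: contra_notP => nA A /[dup] aA /(SigmaP _ agt1)[F [FK Fc] AF] AD.
apply: (Sigma_Pi b1 ba); rewrite AF; apply: Sigma_bigcup => // B FB.
apply: contrapT => nB; apply: nA; exists B; split=> //.
  by apply: subset_trans AD; rewrite AF => x Bx; exists B.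
have [c [c1 /alim[e ce ea] cB]] := Fc B FB.
exists e; split=> //; first by exists c.
exact: Pi_Sigma ce cB.
Qed.

(** In the k-th set pick a subset of rank below a but above the k-th term of a
    cofinal sequence.  The union is Delta_a, so of some fixed rank below a; the
    pieces are its traces on sets of fixed rank c, so their ranks are bounded
    too. *)
Lemma no_disjoint_bad_family (E : K -> set X) c :
  (forall A, Delta a A -> exists b, [/\ ord_ge1 b, (b < a)%O & Sg b A]) ->
  ord_ge1 c -> (c < a)%O ->
  (forall k, Sg c (E k)) -> (forall k l x, E k x -> E l x -> k = l) ->
  ~ (forall k, ~ collapsed a (E k)).
Proof.
move=> acollapse c1 ca cE Edisj Ebad; have [f [fa fcof]] := cofinal_family.
have /choice[A AP] : forall k, exists A, [/\ A `<=` E k,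
    exists c, [/\ ord_ge1 c, (c < a)%O & Sg c A] & ~ Sg (f k) A].
  by move=> k; have [f1 f2] := fa k; exact: bad_unbounded.
have AE k : A k `<=` E k by have [] := AP k.
have aA k : Delta a (A k).
  by have [_ [e [e1 ea eA]] _] := AP k; exact: delta_below eA.
have aE k : Delta a (E k) by exact: delta_below (cE k).
have [|b [b1 ba bA]] := acollapse (\bigcup_k A k).
  split; first by apply: Sigma_bigcup => // k _; have [] := aA k.
  rewrite (_ : ~` _ = ~` (\bigcup_k E k) `|` \bigcup_k (E k `&` ~` A k)).
    apply: Sigma_setU => //; last first.
      apply: Sigma_bigcup => // k _; apply: Sigma_setI => //.
        by have [] := aE k.
      by have [] := aA k.
    by apply: (Sigma_Pi c1 ca); exact: Sigma_bigcup.
  apply/seteqP; split=> x.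
    move=> nA; have [[k _ Ek]|nE] := pselect ((\bigcup_k E k) x); [right|by left].
    by exists k => //; split=> // Ak; apply: nA; exists k.
  move=> [nE [k _ /AE Ek]|[k _ [Ek nAk]] [l _ Al]]; first by apply: nE; exists k.
  by apply: nAk; rewrite (Edisj k l x)//; exact: AE.
(* max b c bounds the rank of every piece *)
have [k bk] : exists k, (Order.max b c <= f k)%O.
  by apply: fcof; rewrite gt_max ba.
have [f1 _] := fa k; have [_ _] := AP k; apply.
move: bk; rewrite ge_max => /andP[bk ck].
rewrite (_ : A k = E k `&` \bigcup_k A k).
  by apply: Sigma_setI => //; [exact: Sigma_le (cE k)|exact: Sigma_le bA].
apply/seteqP; split=> x; first by move=> Ax; split; [exact: AE|exists k].
by move=> [Ek [l _ Al]]; rewrite (Edisj k l x)//; exact: AE.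
Qed.

Hypothesis Ktwo : forall A : set K, card_lt A [set: K] ->
  [set B | B `<=` A] #<= [set: K].

(** Split the space along the small well-order of K.  S x k is the open set used
    at stage k on the branch of x, and D x k is the cell of x just before that
    stage: the points lying on the same side as x of all earlier S x j. *)
Lemma limit_step : exists2 A, Delta a A &
  forall b, ord_ge1 b -> (b < a)%O -> ~ Sg b A.
Proof.
apply: contrapT => noA.
have acollapse A : Delta a A -> exists b, [/\ ord_ge1 b, (b < a)%O & Sg b A].
  move=> aA; apply: contrapT => nb; apply: noA; exists A => // b b1 ba bA.
  by apply: nb; exists b.
(* cells are intersections of open and closed sets, hence Pi at any level c
   above 1, and both Sigma and Pi at the next level e *)
have [z [z1 _] /alim[c zc /alim[e ce ea]]] := ord_one_lt agt1.
have cgt1 : ord_gt1 c by exists z.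
have c1 := ord_gt1_ge1 cgt1.
have e1 : ord_ge1 e by exists c.
have [lt [wf tr tot] small] := exists_initial_wo K.
have /choice[spl splP] : forall D, exists U, open U /\ (Delta a D -> ~ collapsed a D ->
    ~ collapsed a (D `&` U) /\ ~ collapsed a (D `&` ~` U)).
  move=> D.
  have [[[D1 D2] D3]|nD] := pselect (Delta a D /\ ~ collapsed a D); last first.
    by exists set0; split; [exact: open0|move=> ? ?; case: nD].
  by have [U [? ? ?]] := bad_split agt1 D1 D2 D3; exists U.
have /choice[S SE] : forall x, exists S : K -> set X, forall k,
    S k = spl [set y | forall j, lt j k -> (S j y <-> S j x)].
  move=> x; have [S SE] := wf_recursion (fun k (rec : forall j, lt j k -> set X) =>
    spl [set y | forall j (jk : lt j k), rec j jk y <-> rec j jk x]) wf.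
  by exists S.
pose D x k := [set y | forall j, lt j k -> (S x j y <-> S x j x)].
have Sop x k : open (S x k) by rewrite SE; have [] := splP (D x k).
have Dc x k : Sg c (~` D x k).
  rewrite (_ : ~` _ = \bigcup_(j in [set j | lt j k])
      (if pselect (S x j x) is left _ then ~` S x j else S x j)).
    apply: Sigma_bigcup => //; first exact: card_leT.
    move=> j _; case: pselect => _; last exact: open_Sigma.
    by apply: closed_Sigma => //; exact: open_closedC.
  apply/seteqP; split=> y.
    move=> /existsNP[j /not_implyP[jk nj]]; exists j => //.
    by case: pselect => Sx; [move=> Sy|apply: contrapT => Sy]; apply: nj.
  move=> [j jk]; case: pselect => Sx Sy /(_ j jk)[]; first by move=> _ /(_ Sx).
  by move=> /(_ Sy).
have De x k : Sg e (D x k) by exact: Pi_Sigma ce (Dc x k).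
have Da x k : Delta a (D x k) by exact: delta_below (De x k).
have [Dx|] := pselect (forall x, exists k, collapsed a (D x k)); last first.
  (* a branch that never reaches a collapsing cell cuts off disjoint
     non-collapsing halves E k, one at each stage k *)
  move=> /existsNP[x /forallNP badx].
  pose E k := if pselect (S x k x) is left _ then D x k `&` ~` S x k
              else D x k `&` S x k.
  have ED k : E k `<=` D x k by rewrite /E; case: pselect => _ y [].
  have ES k y : E k y -> ~ (S x k y <-> S x k x).
    by rewrite /E; case: pselect => Sx [_ /= Sy]; tauto.
  apply: (no_disjoint_bad_family (E := E) acollapse e1 ea).
  - move=> k; rewrite /E; case: pselect => _; apply: Sigma_setI => //.
      apply: closed_Sigma => //; last exact: open_closedC.
      by apply: ord_gt1_le cgt1 _; exact: ltW.
    exact: open_Sigma.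
  - move=> k l y Ek El; apply: contrapT => /tot[kl|lk].
      by apply: ES Ek _; exact: ED El k kl.
    by apply: ES El _; exact: ED Ek l lk.
  - move=> k; have [_ /(_ (Da x k) (badx k))] := splP (D x k).
    by rewrite -SE /E => -[? ?]; case: pselect.
(* a cell is determined by the sides chosen at the earlier stages *)
have DE x y k : (forall j, lt j k -> (S x j x <-> S y j y)) -> D x k = D y k.
  elim: (wf k) => {}k _ IH H.
  have SS j : lt j k -> S x j = S y j.
    move=> jk; rewrite !SE; congr spl; apply: IH => // i ij.
    by apply/H/(tr _ _ _ ij).
  apply/seteqP; split=> w H' j jk; have := H' j jk; have := H j jk;
    by rewrite SS//; tauto.
have [k0 _] := infinite_setN0 Kinf.
have /choice[h hinj] : forall k, exists h : set K -> K, forall A B : set K,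
    A `<=` [set j | lt j k] -> B `<=` [set j | lt j k] -> h A = h B -> A = B.
  move=> k; have [|h [_ hi]] := card_le_injP k0 (Ktwo (A := [set j | lt j k]) _).
    by split; [exact: card_leT|exact: small].
  by exists h.
pose G := [set B | exists x k, B = D x k /\ collapsed a B].
apply: abad; rewrite (_ : [set: X] = \bigcup_(B in G) B).
  apply: collapsed_bigcup => //.
  - apply: card_le_trans (infinite_card_square Kinf).
    pose bits x k := [set j | lt j k /\ S x j x].
    have /choice[r rP] : forall B, exists q : K * K, G B ->
        exists2 x, B = D x q.1 & q.2 = h q.1 (bits x q.1).
      move=> B; have [[x [k [BD _]]]|nG] := pselect (G B); last by exists (k0, k0).
      by exists (k, h k (bits x k)) => _; exists x.
    apply: (card_le_inj (f := r)) => // A B /rP[x AD rx] /rP[y BD ry] rE.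
    rewrite AD BD -rE; apply: DE => j jk.
    move: ry; rewrite -rE rx => /hinj bE.
    have bj : bits x (r A).1 j = bits y (r A).1 j by rewrite bE// => i [].
    by split=> Sj; [have [] : bits y (r A).1 j by rewrite -bj|
                    have [] : bits x (r A).1 j by rewrite bj].
  - by move=> _ [x [k [-> _]]]; have [] := Da x k.
  - by move=> B [x [k []]].
  - rewrite (_ : ~` _ = set0); first exact: Sigma0.
    rewrite -setCT; congr (~` _); apply/seteqP; split=> // x _.
    by have [k gk] := Dx x; exists (D x k) => //; exists x, k.
apply/seteqP; split=> // x _.
by have [k gk] := Dx x; exists (D x k) => //; exists x, k.
Qed.

End Limit.

End Levels.

Unset Implicit Arguments.

Theorem corollary4p5 (K : Type) (X : topologicalType)
    (d : Order.disp_t) (W : orderType d) (o a : W) :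
  ~ countable [set: K] ->
  two_pow_lt_eq K ->
  [set: X] !=set0 ->
  regular_space X ->
  hausdorff_space X ->
  weight_le X K ->
  well_order (<=%O : rel W) ->
  is_ord K X o ->
  ord_ge1 a ->
  (a < o)%O ->
  [/\ kDelta K X a `<` kSigma K X a,
      kDelta K X a `<` kPi K X a &
      \bigcup_(b in [set b : W | ord_ge1 b /\ (b < a)%O])
        (kSigma K X b `|` kPi K X b)
      `<` kDelta K X a].
Proof.
move=> Kunc [Ktwo _] _ regX hausX weightX Wwo oP a1 ao.
have Kinf : infinite_set [set: K] by move=> /finite_set_countable.
have Wwf : well_founded (fun x y : W => (x < y)%O).
  have [wf _ _] := well_order_wf Wwo; apply: min_well_founded => P.
  move=> /(well_founded_min wf)[m Pm mmin]; exists m => // x xm; apply: mmin.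
  split; first exact: ltW.
  by move=> xE; rewrite xE ltxx in xm.
have bad b : ord_ge1 b -> (b < o)%O -> ~ collapsed K b [set: X].
  by move=> b1 bo; exact: (bad_below_ord Kinf Wwf regX weightX oP).
have abad := bad a a1 ao.
have DeltaE A : kDelta K X a A <-> Delta K a A.
  by split=> -[aA /PiP aAC].
split.
- split=> [A []//|sub]; apply: abad => A aA _.
  by have [_ /PiP] := sub _ aA.
- split=> [A []//|sub]; apply: abad => A aA _.
  by have [] := sub _ (kPi_compl aA).
split=> [A [b [b1 ba] bA]|sub].
  apply/DeltaE; case: bA => [|/PiP] bA.
    exact: (delta_below Kinf Wwf regX weightX b1 ba bA).
  have [? ?] := delta_below Kinf Wwf regX weightX b1 ba bA.
  by split=> //; rewrite -(setCK A).
have {}sub A : Delta K a A ->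
    exists b, [/\ ord_ge1 b, (b < a)%O & kSigma K X b A \/ kSigma K X b (~` A)].
  by move=> /DeltaE/sub[b [b1 ba] [bA|/PiP bA]]; exists b; split=> //; [left|right].
have [[_ agt1]|agt1] := ord_ge1_cases a1.
  have [|b [b1 ba _]] := sub set0; last by apply: agt1; exists b.
  split; first by apply: (Sigma0 Wwf regX weightX).
  by rewrite setC0; apply: (open_Sigma Wwf regX weightX) => //; exact: openT.
have [alim|] := pselect (forall b, (b < a)%O -> exists2 c, (b < c)%O & (c < a)%O).
  have [A /sub[b [b1 ba bA]] nA] :=
    limit_step Kinf Wwf regX weightX hausX agt1 alim abad Ktwo.
  case: bA => [|bA]; first exact: nA.
  have [c bc ca] := alim b ba; apply: (nA c _ ca); first by exists b.
  exact: (Pi_Sigma Kinf b1 bc).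
move=> /existsNP[b /not_implyP[ba bmax]].
have le_b c : (c < a)%O -> (c <= b)%O.
  move=> ca; rewrite leNgt; apply/negP => bc.
  by apply: bmax; exists c.
have b1 : ord_ge1 b.
  by have [e e1 /le_b] := agt1; exact: ord_ge1_le.
have {}sub A : Delta K a A -> kSigma K X b A \/ kSigma K X b (~` A).
  move=> /sub[c [c1 /le_b cb [cA|cA]]]; [left|right];
    exact: (Sigma_le Wwf regX weightX c1 cb).
have [be1|bgt1] := ord_ge1_cases b1.
  have [A /sub + [nop ncl]] := second_step Kinf Wwf regX weightX hausX agt1 abad.
  rewrite kSigma1E// => -[//|/open_closedC]; by rewrite setCK.
have bbad := bad b b1 (lt_trans ba ao).
by have [A /sub[] ? []] := successor_step Kinf Wwf regX weightX hausX bgt1 ba bbad.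
Qed.
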